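(* Let $n\ge 2$ be even, $k\ge 1$, $\lambda<0$, $A_1<0$, $f(T)=A_1T$, and $R(x_{n+1})=\sum_{l=1}^{k}d_{2l}\,x_{n+1}^{2l}$ with $d_{2l}>0$ for $l=1,\dots,k$. Let $a_1,a_2\in\mathbb{R}$ and, for $j=2,\dots,n/2$, let $a_{2j-1},a_{2j}\in\mathbb{R}[x_1,\dots,x_{2j-2}]$, and suppose that for each $j=1,\dots,n/2$ one has $a_{2j-1}=a_{2j}$ or $a_{2j-1}=-a_{2j}$, and that $a_{2j-1}^2<\lambda/A_1$ (everywhere). Define $H=(H_1,\dots,H_n)$ by, for $j=1,\dots,n/2$, $$H_{2j-1}=a_{2j}\,f(a_{2j-1}x_{2j-1}+a_{2j}x_{2j}),\qquad H_{2j}=-a_{2j-1}\,f(a_{2j-1}x_{2j-1}+a_{2j}x_{2j}),$$ and, with $x=(x_1,\dots,x_n)$, let $F:\mathbb{R}^{n+1}\to\mathbb{R}^{n+1}$ be $$F(x_1,\dots,x_{n+1})=(-x_2,x_1,-x_4,x_3,\dots,-x_n,x_{n-1},-x_{n+1}R(x_{n+1}))+R(x_{n+1})\,(\lambda x+H(x),0).$$ Let $\alpha$ be a real number such that, for all $j=1,\dots,n/2$, $$\alpha>\max\left\{2,\ \frac{3-n\lambda}{2},\ \frac{2k+1-n\lambda}{2(a_{2j-1}^2A_1-\lambda)}\right\}.$$ Then the function $$\rho(x_1,\dots,x_{n+1})=\frac{1}{(x_1^2+\cdots+x_n^2+R(x_{n+1}))^{\alpha}}$$ is a density function of the system whose right-hand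 side is $F$, i.e. of $(\dot x_1,\dots,\dot x_{n+1})=F(x_1,\dots,x_{n+1})$.
   Context: A density function of a system $\dot x=F(x)$ on $\mathbb{R}^d$ is a $C^1$ map $\rho:\mathbb{R}^d\setminus\{0\}\to[0,+\infty)$, integrable outside a ball centered at the origin, such that $[\nabla\cdot(\rho F)](x)>0$ for almost every $x\in\mathbb{R}^d$ (Lebesgue measure), where $\nabla\cdot(\rho F)=\nabla\rho\cdot F+\rho\,(\nabla\cdot F)$, with $\nabla\rho$ the gradient of $\rho$ and $\nabla\cdot F$ the divergence of $F$. In the definition of $H$, the coefficients $a_{2j-1},a_{2j}$ are evaluated at $(x_1,\dots,x_{2j-2})$ (constants when $j=1$). *)

(* Defs.v *)
From HB Require Import structures.
From mathcomp Require Import all_boot all_order all_algebra.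
From mathcomp Require Import all_classical all_reals all_analysis.
From mathcomp Require mpoly.
(* The notations of mpoly clash with those of MathComp-Analysis: only its
   canonical structures are imported, and its names are used qualified. *)
Import (canonicals) mpoly.

Set Implicit Arguments.
Unset Strict Implicit.
Unset Printing Implicit Defensive.

Import Order.TTheory GRing.Theory Num.Theory.
Import numFieldNormedType.Exports.

Local Open Scope classical_set_scope.
Local Open Scope ring_scope.

(* The sigma-algebra generated by the coordinate functions, i.e. the Borel
   sigma-algebra of R^d. *)
Section measurable_rV.
Context (R : realType) (d : nat).

Let coord (i : 'I_d) (x : 'rV[R]_d) : R := x 0 i.

Let rV_set0 : g_sigma_preimage coord set0.
Proof. exact: sigma_algebra0. Qed.

Let rV_setC A : g_sigma_preimage coord A -> g_sigma_preimage coord (~` A).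
Proof. exact: sigma_algebraC. Qed.

Let rV_bigcup (F : (set 'rV[R]_d)^nat) :
  (forall i, g_sigma_preimage coord (F i)) ->
  g_sigma_preimage coord (\bigcup_i F i).
Proof. exact: sigma_algebra_bigcup. Qed.

HB.instance Definition _ := @isMeasurable.Build default_measure_display
  'rV[R]_d (g_sigma_preimage coord) rV_set0 rV_setC rV_bigcup.

End measurable_rV.

Lemma measurable_coord (R : realType) (d : nat) (i : 'I_d) :
  measurable_fun [set: 'rV[R]_d] (fun x => x 0 i : R).
Proof.
move=> _ Y mY; rewrite setTI; apply: sub_sigma_algebra => /=.
rewrite -bigcup_seq/=; exists i => /=; first by rewrite mem_index_enum.
by exists Y => //; rewrite setTI.
Qed.

Lemma measurable_rVP d1 (T : measurableType d1) (R : realType) (d : nat)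
    (f : T -> 'rV[R]_d) :
  (forall i, measurable_fun [set: T] (fun t => f t 0 i : R)) ->
  measurable_fun [set: T] f.
Proof.
move=> mf _ A mA.
suff : <<s \big[setU/set0]_(i < d) preimage_set_system setT
    (fun x : 'rV[R]_d => x 0 i : R) measurable >> `<=`
    [set B | measurable (setT `&` f @^-1` B)] by exact.
apply: smallest_sub.
  split => /=.
  - by rewrite preimage_set0 setI0.
  - by move=> B mB; rewrite setTD preimage_setC setTI; apply: measurableC;
      rewrite -[X in measurable X]setTI.
  - move=> F mF; rewrite preimage_bigcup setTI; apply: bigcupT_measurable => i.
    by rewrite -[X in measurable X]setTI; exact: mF.
rewrite -bigcup_seq => B [i _ [C mC <-]] /=.
by rewrite (setTI (_ @^-1` C)); exact: (mf i measurableT C mC).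
Qed.

Definition rV_cons (R : realType) (d : nat) (p : R * 'rV[R]_d) : 'rV[R]_d.+1 :=
  row_mx (p.1%:M : 'rV[R]_1) p.2.

Definition rV_uncons (R : realType) (d : nat) (x : 'rV[R]_d.+1) :
    R * 'rV[R]_d :=
  (x 0 ord0, \row_j x 0 (lift ord0 j)).

Lemma rV_cons0 (R : realType) (d : nat) (p : R * 'rV[R]_d) :
  rV_cons p 0 ord0 = p.1.
Proof.
rewrite /rV_cons (_ : ord0 = lshift d (ord0 : 'I_1)); last exact: val_inj.
by rewrite (row_mxEl (p.1%:M : 'rV[R]_1) p.2) mxE eqxx.
Qed.

Lemma rV_consS (R : realType) (d : nat) (p : R * 'rV[R]_d) (j : 'I_d) :
  rV_cons p 0 (lift ord0 j) = p.2 0 j.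
Proof.
rewrite /rV_cons (_ : lift ord0 j = rshift 1 j); last exact: val_inj.
exact: (row_mxEr (p.1%:M : 'rV[R]_1) p.2).
Qed.

Lemma rV_consK (R : realType) (d : nat) : cancel (@rV_cons R d) (@rV_uncons R d).
Proof.
move=> [a x]; rewrite /rV_uncons rV_cons0; congr pair.
by apply/rowP => j; rewrite mxE rV_consS.
Qed.

Lemma measurable_rV_cons (R : realType) (d : nat) :
  measurable_fun [set: R * 'rV[R]_d] (@rV_cons R d).
Proof.
apply: measurable_rVP => i; case: (unliftP ord0 i) => [j ->|->].
- under eq_fun do rewrite rV_consS.
  exact: (measurableT_comp (@measurable_coord R d j) measurable_snd).
- by under eq_fun do rewrite rV_cons0; exact: measurable_fst.
Qed.

Lemma measurable_rV_uncons (R : realType) (d : nat) :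
  measurable_fun [set: 'rV[R]_d.+1] (@rV_uncons R d).
Proof.
apply: measurable_fun_pair; first exact: measurable_coord.
apply: measurable_rVP => j.
rewrite (_ : (fun _ => _) = (fun x : 'rV[R]_d.+1 => x 0 (lift ord0 j))).
  exact: measurable_coord.
by apply/funext => x /=; rewrite mxE.
Qed.

Section lebesgue_rV_step.
Context (R : realType) (d : nat).
Variable mu : {sigma_finite_measure set 'rV[R]_d -> \bar R}.

Definition lebesgue_rV_step : set 'rV[R]_d.+1 -> \bar R :=
  pushforward (@lebesgue_measure R \x mu)%E (@rV_cons R d).

Let mpre (A : set 'rV[R]_d.+1) : measurable A -> measurable (@rV_cons R d @^-1` A).
Proof.
by move=> mA; rewrite -[X in measurable X]setTI; exact: measurable_rV_cons.
Qed.

Let step0 : lebesgue_rV_step set0 = 0%E.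
Proof. by rewrite /lebesgue_rV_step /pushforward preimage_set0 measure0. Qed.

Let step_ge0 A : (0 <= lebesgue_rV_step A)%E.
Proof. by rewrite /lebesgue_rV_step /pushforward; exact: measure_ge0. Qed.

Let step_sigma_additive : semi_sigma_additive lebesgue_rV_step.
Proof.
move=> F mF tF mUF; rewrite /lebesgue_rV_step /pushforward preimage_bigcup.
apply: measure_semi_sigma_additive.
- by move=> n; apply: mpre.
- apply/trivIsetP => /= i j _ _ ij; rewrite -preimage_setI.
  by move/trivIsetP : tF => /(_ _ _ _ _ ij) ->//; rewrite preimage_set0.
- by rewrite -preimage_bigcup; apply: mpre.
Qed.

HB.instance Definition _ := isMeasure.Build _ _ _ lebesgue_rV_step
  step0 step_ge0 step_sigma_additive.

Let step_sigma_finite : sigma_finite setT lebesgue_rV_step.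
Proof.
have /sigma_finiteP[F [TF ndF Foo]] := sigma_finiteT (@lebesgue_measure R).
have /sigma_finiteP[G [TG ndG Goo]] := sigma_finiteT mu.
exists (fun n => @rV_uncons R d @^-1` (F n `*` G n)).
  rewrite -preimage_bigcup (_ : \bigcup_n _ = setT) ?preimage_setT//.
  apply/seteqP; split => // -[x y] _.
  have [n _ Fnx] : (\bigcup_n F n) x by rewrite -TF.
  have [k _ Gky] : (\bigcup_n G n) y by rewrite -TG.
  exists (maxn n k) => //; split => /=.
  - by move: x Fnx; exact/subsetPset/ndF/leq_maxl.
  - by move: y Gky; exact/subsetPset/ndG/leq_maxr.
move=> n; have [mF Fn] := Foo n; have [mG Gn] := Goo n; split.
  rewrite -[X in measurable X]setTI; apply: measurable_rV_uncons => //.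
  exact: measurableX.
rewrite /lebesgue_rV_step /pushforward -comp_preimage.
rewrite (_ : _ \o _ = id); last by apply/funext => p; exact: rV_consK.
rewrite preimage_id product_measure1E//.
by rewrite lte_mul_pinfty// ge0_fin_numE.
Qed.

HB.instance Definition _ := Measure_isSigmaFinite.Build _ _ _ lebesgue_rV_step
  step_sigma_finite.

End lebesgue_rV_step.

(* The Lebesgue measure on the Borel sets of R^d, as the d-fold product of the
   one-dimensional one. *)
Fixpoint lebesgue_rV (R : realType) (d : nat) :
    {sigma_finite_measure set 'rV[R]_d -> \bar R} :=
  match d with
  | 0 => \d_(0 : 'rV[R]_0)
  | d'.+1 => lebesgue_rV_step (lebesgue_rV R d')
  end.

Definition euclid_norm (R : realType) (d : nat) (x : 'rV[R]_d) : R :=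
  Num.sqrt (\sum_i x 0 i ^+ 2).

Definition partial (R : realType) (d : nat) (f : 'rV[R]_d -> R) (i : 'I_d)
    (x : 'rV[R]_d) : R :=
  'D_(delta_mx 0 i) f x.

Definition grad (R : realType) (d : nat) (f : 'rV[R]_d -> R) (x : 'rV[R]_d) :
    'rV[R]_d :=
  \row_i partial f i x.

Definition divergence (R : realType) (d : nat) (F : 'rV[R]_d -> 'rV[R]_d)
    (x : 'rV[R]_d) : R :=
  \sum_i partial (fun z => F z 0 i) i x.

(* div (rho F) *)
Definition divergence_scaled (R : realType) (d : nat) (rho : 'rV[R]_d -> R)
    (F : 'rV[R]_d -> 'rV[R]_d) (x : 'rV[R]_d) : R :=
  (\sum_i grad rho x 0 i * F x 0 i) + rho x * divergence F x.

(* [rho] stands for a function on R^d minus the origin: its value at 0 is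
   irrelevant. *)
Definition is_density_function (R : realType) (d : nat)
    (F : 'rV[R]_d -> 'rV[R]_d) (rho : 'rV[R]_d -> R) : Prop :=
  [/\ forall x, x != 0 -> 0 <= rho x,
      forall x, x != 0 ->
        differentiable rho x /\ {for x, continuous (grad rho)},
      exists2 r : R, 0 < r &
        (lebesgue_rV R d).-integrable [set x | r <= euclid_norm x]
          (fun x => (rho x)%:E)
    & {ae lebesgue_rV R d, forall x, 0 < divergence_scaled rho F x}].

(* [entry x i] is x_(i+1) for i < n: components are indexed from 0. *)
Definition entry (R : realType) (n : nat) (x : 'rV[R]_n) (i : nat) : R :=
  if insub i is Some k then x 0 k else 0.

(* (-x_2, x_1, -x_4, x_3, ..., -x_n, x_(n-1)), for n even *)
Definition rotation (R : realType) (n : nat) (x : 'rV[R]_n) : 'rV[R]_n :=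
  \row_(i < n) if odd i then entry x i.-1 else - entry x i.+1.

(* [a j] and [b j] are the polynomials a_(2j+1) and a_(2j+2), in the first 2j
   variables, so that j < n/2 ranges over the pairs of components
   (x_(2j+1), x_(2j+2)). *)
Definition H_map (R : realType) (n : nat) (f : R -> R)
    (a b : forall j : nat, mpoly.mpoly j.*2 R) (x : 'rV[R]_n) : 'rV[R]_n :=
  \row_(i < n)
    let j := i./2 in
    let aj := mpoly.meval (fun l : 'I_(j.*2) => entry x l) (a j) in
    let bj := mpoly.meval (fun l : 'I_(j.*2) => entry x l) (b j) in
    let t := f (aj * entry x j.*2 + bj * entry x j.*2.+1) in
    if odd i then - aj * t else bj * t.

(* [d i] is the coefficient d_i; only those of even index i = 2l matter. *)
Definition R_poly (R : realType) (k : nat) (d : nat -> R) (y : R) : R :=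
  \sum_(1 <= l < k.+1) d l.*2 * y ^+ l.*2.

(* A point of R^(n+1) is (x, y), with x the first n components and y the last
   one. *)
Definition F_map (R : realType) (n : nat) (Rf : R -> R) (lambda : R)
    (H : 'rV[R]_n -> 'rV[R]_n) (z : 'rV[R]_(n + 1)) : 'rV[R]_(n + 1) :=
  let x := lsubmx z in
  let y := rsubmx z 0 0 in
  row_mx (rotation x) (- y * Rf y)%:M
    + Rf y *: row_mx (lambda *: x + H x) 0.

Definition rho_map (R : realType) (n : nat) (Rf : R -> R) (alpha : R)
    (z : 'rV[R]_(n + 1)) : R :=
  let x := lsubmx z in
  let y := rsubmx z 0 0 in
  1 / (((\sum_i x 0 i ^+ 2) + Rf y) `^ alpha).

(* Main.v *)
(* Write Q = |x|^2 + R(y), y being the last coordinate, so that rho = Q^-alpha.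
   - Divergence: the rotation is orthogonal to x, div H = 0, and since
     a_(2j-1)^2 = a_(2j)^2 the scalar product x.H is a sum of multiples of
     x_(2j-1)^2 - x_(2j)^2.  Together with 2R <= yR' <= 2kR this gives
     div(rho F) > 0 wherever R(y) > 0, that is off the null hyperplane y = 0.
   - Integrability: the conditions on alpha force alpha > (n + 3)/2, and Q
     dominates a multiple of |(x, y)|^2, so that in dimension N = n + 1 rho
     decays at least like |(x, y)|^-(N+1); summing over dyadic cubes gives a
     geometric series. *)
Require Import Defs.
From mathcomp Require Import all_boot all_order all_algebra.
From mathcomp Require Import all_classical all_reals all_analysis.
From mathcomp Require Import measurable_realfun zify ring lra.
From mathcomp Require mpoly.
Import (canonicals) mpoly.
Import Order.TTheory GRing.Theory Num.Theory.
Import numFieldNormedType.Exports.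
Local Open Scope classical_set_scope.
Local Open Scope ring_scope.

(** * Lebesgue measure on R^d *)

(** The recursion step of the product measure. [C] is described pointwise, by its first entry and
    the row of the others, so that hyperplanes and cubes can be measured by induction on the
    dimension. *)
Lemma lebesgue_rV_S (R : realType) (d : nat) (B : set R) (A : set 'rV[R]_d)
    (C : set 'rV[R]_d.+1) :
  measurable B -> measurable A ->
  (forall x, C x <-> B (x 0 ord0) /\ A (\row_j x 0 (lift ord0 j))) ->
  (lebesgue_rV R d.+1 C = lebesgue_measure B * lebesgue_rV R d A)%E.
Proof.
move=> mB mA CE; rewrite -product_measure1E//.
rewrite -[LHS]/((lebesgue_measure \x lebesgue_rV R d)%E (@rV_cons R d @^-1` C)).
congr (product_measure1 _ _ _); apply/seteqP.
have E (p : R * 'rV[R]_d) : \row_j rV_cons p 0 (lift ord0 j) = p.2.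
  by apply/rowP => j; rewrite mxE rV_consS.
split=> p.
- by move=> /CE; rewrite rV_cons0 E.
- by move=> Bp; apply/CE; rewrite rV_cons0 E.
Qed.

Lemma measurable_row_preimage (R : realType) (d : nat) (i : 'I_d) (B : set R) :
  measurable B -> measurable [set x : 'rV[R]_d | B (x 0 i)].
Proof.
by move=> mB; rewrite -[X in measurable X]setTI; exact: (measurable_coord i).
Qed.

(** By induction on the dimension, one factor of the product is null, and it prevails even over a
    factor of infinite measure, as 0 times +oo is 0. *)
Lemma lebesgue_rV_coord0 (R : realType) (d : nat) (i : 'I_d) :
  lebesgue_rV R d [set x | x 0 i = 0] = 0%E.
Proof.
elim: d i => [[]//|d IH] i; case: (unliftP ord0 i) => [j ->|->].
- rewrite (@lebesgue_rV_S R d setT [set x | x 0 j = 0]).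
  + by rewrite IH mule0.
  + exact: measurableT.
  + exact: (measurable_row_preimage _ _ j _ (measurable_set1 0)).
  + by move=> x /=; rewrite mxE; split=> [|[]].
- rewrite (@lebesgue_rV_S R d [set 0] setT).
  + by rewrite lebesgue_measure_set1 mul0e.
  + exact: measurable_set1.
  + exact: measurableT.
  + by move=> x /=; split=> [|[]].
Qed.

Definition cube {R : realType} {d : nat} (r : R) : set 'rV[R]_d :=
  [set x | forall i, `|x 0 i| <= r].

Lemma measurable_cube (R : realType) (d : nat) (r : R) :
  measurable (@cube R d r).
Proof.
rewrite (_ : cube r = \bigcap_(i in [set: 'I_d])
    [set x | [set` `[- r, r]] (x 0 i)]).
  apply: fin_bigcap_measurable => [|i _]; first exact: finite_finset.
  by apply: measurable_row_preimage; exact: measurable_itv.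
apply/seteqP; split=> x /= h i.
  by move=> _ /=; rewrite in_itv/= -ler_norml.
by have := h i Logic.I; rewrite /= in_itv/= -ler_norml.
Qed.

Lemma lebesgue_rV_cube (R : realType) (d : nat) (r : R) : 0 <= r ->
  lebesgue_rV R d (cube r) = ((r *+ 2) ^+ d)%:E.
Proof.
move=> r0; elim: d => [|d IH].
  by rewrite expr0 /= diracE mem_set// => -[].
rewrite (@lebesgue_rV_S R d [set` `[- r, r]] (cube r)).
(* The length formula tests whether - r < r; otherwise r = 0 and both sides vanish. *)
- by rewrite IH lebesgue_measure_itv/= lte_fin exprS EFinM;
    case: ltP => [_|rr]; rewrite ?opprK -?EFinB ?opprK -?mulr2n//;
    rewrite (_ : r = 0) ?mul0rn ?mul0r ?mul0e//; lra.
- exact: measurable_itv.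
- exact: measurable_cube.
- move=> x; rewrite /cube /= in_itv/= -ler_norml; split=> [h|[h0 h] i].
    by split => // j; rewrite mxE.
  by case: (unliftP ord0 i) => [j ->|->//]; have := h j; rewrite mxE.
Qed.

(** The shell between the cubes of half-sides 2^m and 2^(m+1) has volume at most (4 2^m)^d, and f is
    at most C / 2^(m(d+1)) there, so it contributes at most C 4^d / 2^m. Instead of a partition into
    shells, f is dominated by the sum over m of multiples [g m] of indicator functions of cubes. *)
Lemma integrable_decay (R : realType) (d : nat) (D : set 'rV[R]_d)
    (f : 'rV[R]_d -> R) (C : R) :
  measurable D -> measurable_fun D f -> (forall x, D x -> 0 <= f x) ->
  (forall x, D x -> ~ cube 1 x) ->
  (forall x m, D x -> ~ cube (2 ^+ m) x -> f x <= C / (2 ^+ m) ^+ d.+1) ->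
  (lebesgue_rV R d).-integrable D (EFin \o f).
Proof.
move=> mD mf f0 D1 fC.
(* A point of D is what yields 0 <= C, hence the separate case of an empty D. *)
have [[x0 Dx0]|D0] := pselect (exists x, D x); last first.
  rewrite (_ : D = set0); first exact: integrable_set0.
  by apply/seteqP; split=> // x Dx; case: D0; exists x.
have C0 : 0 <= C.
  have := fC x0 0%N Dx0; rewrite expr0 expr1n divr1 => /(_ (D1 _ Dx0)).
  exact/le_trans/f0.
apply/integrableP; split; first exact/measurable_EFinP.
pose g m (x : 'rV[R]_d) :=
  ((C / (2 ^+ m) ^+ d.+1) * \1_(cube (2 ^+ m.+1)) x)%:E.
have g0 m x : (0 <= g m x)%E.
  by rewrite lee_fin mulr_ge0// divr_ge0// !exprn_ge0.
have mg m : measurable_fun D (g m).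
  apply/measurable_EFinP; apply: measurable_funM => //.
  by apply: measurable_indic; exact: measurable_cube.
apply: (@le_lt_trans _ _
  (\int[lebesgue_rV R d]_(x in D) (\sum_(m <oo) g m x))%E).
  apply: ge0_le_integral => //.
  - by apply: measurableT_comp => //; exact/measurable_EFinP.
  - by apply: ge0_emeasurable_sum => // *; exact: mg.
  - move=> x Dx; rewrite /= ger0_norm ?f0//.
    (* The least m with x in the cube of half-side 2^m is positive, as D avoids the unit cube; its
       predecessor m' indexes the shell of x. *)
    have exm : exists m, `[< cube (2 ^+ m) x >].
      have [m xm] : exists m : nat, \sum_i `|x 0 i| <= m%:R.
        exists (Num.truncn (\sum_i `|x 0 i|)).+1.
        by rewrite ltW// truncnS_gt.
      exists m; apply/asboolP => i.
      apply: (@le_trans _ _ (\sum_i `|x 0 i|)).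
        by rewrite (bigD1 i)//= lerDl sumr_ge0.
      by rewrite (le_trans xm)// -natrX ler_nat ltnW// ltn_expl.
    case: (ex_minnP exm) => -[|m'] /asboolP xm minm.
      by case: (D1 x Dx); rewrite expr0 in xm.
    have xm' : ~ cube (2 ^+ m') x.
      by move=> /asboolP /minm; rewrite ltnn.
    apply: (@le_trans _ _ (g m' x)).
      by rewrite /g indicE mem_set// mulr1 lee_fin fC.
    rewrite (@nneseriesD1 _ (g ^~ x) m')// leeDl//; first exact: nneseries_ge0.
rewrite integral_nneseries//.
(* The bound C 4^d / 2^m gets a factor 2 above and below, to match the standard series of ratio
   1/2. *)
apply: (@le_lt_trans _ _
  (\sum_(m <oo) (C * 4 ^+ d * 2 / (2 ^ (m + 1))%:R)%:E)%E).
  apply: lee_nneseries => [m _ _|m _]; first exact: integral_ge0.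
  apply: (@le_trans _ _ (\int[lebesgue_rV R d]_x g m x)%E).
    apply: ge0_subset_integral => //.
    apply/measurable_EFinP; apply: measurable_funM => //.
    by apply: measurable_indic; exact: measurable_cube.
  under eq_integral do rewrite /g EFinM.
  rewrite ge0_integralZl//; last 2 first.
    by apply/measurable_EFinP; apply: measurable_indic; exact: measurable_cube.
    by rewrite lee_fin divr_ge0// !exprn_ge0.
  rewrite integral_indic//; last exact: measurable_cube.
  rewrite setIT [X in (_ * X)%E](@lebesgue_rV_cube R d (2 ^+ m.+1) _)
    ?exprn_ge0// -EFinM lee_fin.
  have -> : (2 ^+ m.+1 *+ 2 : R) = 4 * 2 ^+ m by rewrite exprS; lra.
  rewrite addn1 natrX !exprS exprMn.
  set t := 2 ^+ m; set u := 4 ^+ d; set s := t ^+ d.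
  have t0 : t != 0 by rewrite expf_neq0.
  have s0 : s != 0 by rewrite expf_neq0.
  by rewrite le_eqVlt; apply/orP; left; apply/eqP; field; rewrite t0.
rewrite (cvg_lim _ (@cvg_geometric_eseries_half R (C * 4 ^+ d * 2) 0%N))//.
exact: ltry.
Qed.

(** * Powers of a sum of squares plus a polynomial *)

Lemma is_derive_entry (R : realType) (m : nat) (i : 'I_m) (z v : 'rV[R]_m) :
  is_derive z v (fun x : 'rV[R]_m => x 0 i) (v 0 i).
Proof.
have dz := differentiable_coord z 0 i.
split; first exact: diff_derivable.
apply: cvg_lim => //; apply: (cvg_near_cst (v 0 i)).
near=> h; rewrite /= !mxE addrK [_ *: _]mulrA mulVf ?mul1r//.
by near: h; exact: nbhs_dnbhs_neq.
Unshelve. all: by end_near. Qed.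

(** The difference quotient is constant off h = 0. Each of the first n components of F is affine
    along its own axis, so its diagonal partial derivative is obtained without differentiating the
    polynomials a_j. *)
Lemma derive_affine (R : realType) (V : normedModType R) (f : V -> R) (z v : V)
    (c : R) :
  (forall h, f (h *: v + z) = f z + h * c) -> 'D_v f z = c.
Proof.
move=> fE; apply: cvg_lim => //; apply: (cvg_near_cst c).
near=> h; rewrite /= fE addrAC subrr add0r [_ *: _]mulrA mulVf ?mul1r//.
by near: h; exact: nbhs_dnbhs_neq.
Unshelve. all: by end_near. Qed.

Lemma is_derive_chain (R : realType) (V : normedModType R) (f : V -> R)
    (g : R -> R) (z v : V) (df dg : R) :
  differentiable f z -> is_derive (f z) 1 g dg -> is_derive z v f df ->
  is_derive z v (g \o f) (dg * df).
Proof.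
move=> dfz [ddg <-] [ddf <-].
have dgf : differentiable g (f z) by exact/derivable1_diffP.
split; first exact/diff_derivable/differentiable_comp.
rewrite deriveE; last exact: differentiable_comp.
rewrite diff_comp//= !deriveE// -[in LHS](mulr1 ('d f z v)).
by rewrite [LHS]linearZ /= mulrC.
Qed.

(** A neighbourhood of a row contains a box of neighbourhoods of its entries, and a filter is closed
    under the finite intersection over the columns. *)
Lemma cvg_row (R : realType) (T : Type) (F : set_system T) (m : nat)
    (f : T -> 'rV[R]_m) (l : 'rV[R]_m) : Filter F ->
  (forall i, f x 0 i @[x --> F] --> l 0 i) -> f x @[x --> F] --> l.
Proof.
move=> FF fl A [P lP PA].
have nP : \forall x \near F, forall i, P 0 i (f x 0 i).
  by apply: filter_forall => i; exact: (fl i _ (lP 0 i)).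
by apply: filterS nP => x Px; apply: PA => i j; rewrite ord1.
Qed.

Section sum_of_squares_plus_poly.
Context (R : realType) (n : nat) (P : {poly R}).

Definition sqr_add_poly (z : 'rV[R]_(n + 1)) : R :=
  \sum_i z 0 (lshift 1 i) ^+ 2 + P.[z 0 (rshift n 0)].

(** The scalar product of the gradient of Q at [z] with [v]; at [v = delta_mx 0 i] it is the i-th
    partial derivative. *)
Definition sqr_add_poly_grad (z : 'rV[R]_(n + 1)) (v : 'rV[R]_(n + 1)) : R :=
  \sum_i 2 * z 0 (lshift 1 i) * v 0 (lshift 1 i)
  + P^`().[z 0 (rshift n 0)] * v 0 (rshift n 0).

Local Notation Q := sqr_add_poly.

(** In this point-free form the differentiation rules for sums, powers and composites of functions
    apply. *)
Lemma sqr_add_polyE : sqr_add_poly =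
  \sum_i (fun z : 'rV[R]_(n + 1) => z 0 (lshift 1 i)) ^+ 2
  + (horner P \o (fun z : 'rV[R]_(n + 1) => z 0 (rshift n 0))).
Proof.
apply/funext => z; rewrite /Q fctE; congr (_ + _).
by rewrite fct_sumE.
Qed.

Lemma differentiable_sqr_add_poly z : differentiable Q z.
Proof.
rewrite sqr_add_polyE; apply: differentiableD.
  apply: differentiable_sum => i.
  exact/differentiableX/differentiable_coord.
apply: differentiable_comp; first exact: differentiable_coord.
exact/derivable1_diffP/derivable_horner.
Qed.

Lemma is_derive_sqr_add_poly z v : is_derive z v Q (sqr_add_poly_grad z v).
Proof.
rewrite sqr_add_polyE; apply: is_deriveD.
  apply: is_derive_sum => i.
  apply: is_derive_eq.
    exact/is_deriveX/is_derive_entry.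
  by rewrite expr1.
apply: is_derive_chain; first exact: differentiable_coord.
exact: is_derive_entry.
Qed.

Lemma continuous_sqr_add_poly_grad v :
  continuous (sqr_add_poly_grad ^~ v).
Proof.
move=> z; apply: differentiable_continuous.
rewrite (_ : sqr_add_poly_grad ^~ v =
    \sum_i (fun z : 'rV[R]_(n + 1) => 2 * z 0 (lshift 1 i) * v 0 (lshift 1 i))
    + (horner P^`() \o (fun z : 'rV[R]_(n + 1) => z 0 (rshift n 0)))
      * cst (v 0 (rshift n 0))).
  apply: differentiableD.
    apply: differentiable_sum => i; apply: differentiableM => //.
    by apply: differentiableM => //; exact: differentiable_coord.
  apply: differentiableM => //.
  apply: differentiable_comp; first exact: differentiable_coord.
  exact/derivable1_diffP/derivable_horner.
by apply/funext => x; rewrite !fctE fct_sumE.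
Qed.

Variable a : R.
Local Notation rho := (fun z => Q z `^ a).

Lemma is_derive_powR_sqr_add_poly z v : 0 < Q z ->
  is_derive z v rho (a * Q z `^ (a - 1) * sqr_add_poly_grad z v).
Proof.
move=> Q0; exact: (is_derive_chain _ _ _ (fun x => x `^ a) _ _ _ _
  (differentiable_sqr_add_poly z) (is_derive1_powR a Q0)
  (is_derive_sqr_add_poly z v)).
Qed.

Lemma differentiable_powR_sqr_add_poly z : 0 < Q z -> differentiable rho z.
Proof.
move=> Q0; apply: (@differentiable_comp _ _ _ _ Q (fun x => x `^ a)).
  exact: differentiable_sqr_add_poly.
by apply/derivable1_diffP/derivable_powR; rewrite in_itv/= Q0.
Qed.

Lemma continuous_grad_powR_sqr_add_poly z : 0 < Q z ->
  {for z, continuous (grad rho)}.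
Proof.
move=> Q0; have cQ : {for z, continuous Q}.
  exact/differentiable_continuous/differentiable_sqr_add_poly.
apply: (@cvg_row R _ (nbhs z)) => i; rewrite mxE /partial.
have -> := @derive_val _ _ _ _ _ _ _
  (is_derive_powR_sqr_add_poly z (delta_mx 0 i) Q0).
(* The formula for the gradient is available where Q > 0. This is an open condition, so the formula
   holds near z, which suffices for the limit. *)
have nQ : \forall x \near z, 0 < Q x := cQ _ (lt_nbhsr Q0).
apply: cvg_trans; first apply: (near_eq_cvg
  (f := fun x => a * Q x `^ (a - 1) * sqr_add_poly_grad x (delta_mx 0 i))).
  apply: filterS nQ => x Qx; rewrite mxE /partial.
  by have -> := @derive_val _ _ _ _ _ _ _
    (is_derive_powR_sqr_add_poly x (delta_mx 0 i) Qx).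
apply: cvgM; last exact: continuous_sqr_add_poly_grad.
apply: cvgM; first exact: cvg_cst.
apply: (@continuous_comp _ _ _ Q (fun x => x `^ (a - 1))) => //.
apply/differentiable_continuous/derivable1_diffP/derivable_powR.
by rewrite in_itv/= Q0.
Qed.

End sum_of_squares_plus_poly.

(** * Divergence of the system *)

(** Here r = R(y), w = y R'(y), S = |x|^2, h = x.H(x), l = lambda, nl = n lambda and K = 2k; the
    expression is div(rho F) divided by Q^(-alpha-1). *)
Lemma divergence_sign (R : realFieldType) (alpha nl K S h r w l : R) :
  0 < r -> 2 * r <= w -> w <= K * r -> 0 <= S -> 1 <= alpha ->
  (3 - nl) / 2 < alpha ->
  (K + 1 - nl) * S <= - (2 * alpha) * (l * S + h) ->
  0 < - alpha * (2 * (r * (l * S + h)) - w * r) + (S + r) * (r * (nl - 1) - w).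
Proof.
move=> r0 rw wr S0 a1 anl hS.
(* The expression is exactly the sum of the four quantities below, of which the last is positive. *)
have e1 : 0 <= r * (- (2 * alpha) * (l * S + h) - (K + 1 - nl) * S).
  by rewrite mulr_ge0 ?subr_ge0// ltW.
have e2 : 0 <= S * (K * r - w) by rewrite mulr_ge0 ?subr_ge0.
have e3 : 0 <= r * (alpha - 1) * (w - 2 * r).
  by rewrite !mulr_ge0 ?subr_ge0// ltW.
have e4 : 0 < r * r * (2 * alpha - 3 + nl) by rewrite !mulr_gt0//; lra.
lra.
Qed.

Lemma sum_ord_double (V : nmodType) (m : nat) (G : nat -> V) :
  \sum_(i < m.*2) G i = \sum_(j < m) (G j.*2 + G j.*2.+1).
Proof.
elim: m => [|m IH]; first by rewrite !big_ord0.
by rewrite doubleS !big_ord_recr /= IH addrA.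
Qed.

Lemma entry_ord (R : realType) (n : nat) (x : 'rV[R]_n) (i : 'I_n) :
  entry x i = x 0 i.
Proof. by rewrite /entry valK. Qed.

Lemma entry_lsubmx_shift (R : realType) (n : nat) (h : R) (i : 'I_n)
    (z : 'rV[R]_(n + 1)) (l : nat) :
  entry (lsubmx (h *: delta_mx 0 (lshift 1 i) + z)) l =
  entry (lsubmx z) l + h * (l == i)%:R.
Proof.
rewrite /entry; case: insubP => [k _ <-|nl]; last first.
  rewrite (_ : (l == i) = false) ?mulr0 ?addr0//.
  by apply: contraNF nl => /eqP ->.
by rewrite !mxE eqxx/= addrC eq_lshift.
Qed.

Lemma eq_row_mxl (R : realType) (n p : nat) (u : 'rV[R]_n) (v : 'rV[R]_p) i :
  row_mx u v 0 (lshift p i) = u 0 i.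
Proof. exact: row_mxEl. Qed.

Section R_polynomial.
Context (R : realType) (k : nat) (d : nat -> R).

(** R as a formal polynomial, so that its derivative is algebraic. *)
Definition R_polynomial : {poly R} :=
  \sum_(1 <= l < k.+1) d l.*2 *: 'X^(l.*2).

Lemma R_polyE : R_poly k d = horner R_polynomial.
Proof.
apply/funext => y; rewrite /R_poly /R_polynomial horner_sum.
by apply: eq_bigr => l _; rewrite hornerZ hornerXn.
Qed.

(** The operator y d/dy multiplies y^(2l) by 2l, which lies between 2 and 2k; this is the source of
    the two bounds on y R'(y) below. *)
Lemma mul_deriv_R_polynomial y : y * R_polynomial^`().[y] =
  \sum_(1 <= l < k.+1) l.*2%:R * (d l.*2 * y ^+ l.*2).
Proof.
rewrite /R_polynomial linear_sum horner_sum mulr_sumr !big_seq.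
apply: eq_bigr => l; rewrite mem_index_iota => /andP[l1 _].
rewrite /= derivZ derivXn hornerZ hornerMn hornerXn.
rewrite -[in RHS](prednK (_ : 0 < l.*2)%N) ?double_gt0// exprS
  prednK ?double_gt0//.
by rewrite -mulr_natl; ring.
Qed.

Hypothesis d_gt0 : forall l : nat, (1 <= l <= k)%N -> 0 < d l.*2.

Let term_ge0 l y : (1 <= l < k.+1)%N -> 0 <= d l.*2 * y ^+ l.*2.
Proof.
move=> /d_gt0/ltW dl; rewrite mulr_ge0// -muln2 exprM.
exact: sqr_ge0.
Qed.

Lemma mul_deriv_R_polynomial_ge y :
  2 * R_polynomial.[y] <= y * R_polynomial^`().[y].
Proof.
rewrite mul_deriv_R_polynomial -R_polyE /R_poly mulr_sumr !big_seq.
apply: ler_sum => l; rewrite mem_index_iota => lk.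
rewrite ler_wpM2r ?term_ge0// ler_nat -[2%N]/(1.*2) leq_double.
by case/andP: lk.
Qed.

Lemma mul_deriv_R_polynomial_le y :
  y * R_polynomial^`().[y] <= (2 * k%:R) * R_polynomial.[y].
Proof.
rewrite mul_deriv_R_polynomial -R_polyE /R_poly mulr_sumr !big_seq.
apply: ler_sum => l; rewrite mem_index_iota => lk.
rewrite ler_wpM2r ?term_ge0// -natrM ler_nat mul2n leq_double.
by case/andP: lk.
Qed.

(** Only the term l = 1 is kept. This quadratic growth makes Q comparable from below to the squared
    norm. *)
Lemma R_polynomial_ge_sqr y : (1 <= k)%N -> d 2 * y ^+ 2 <= R_polynomial.[y].
Proof.
move=> k1; rewrite -R_polyE /R_poly big_nat_recl// lerDl big_seq.
apply: sumr_ge0 => l; rewrite mem_index_iota => /andP[l1 lk].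
exact: term_ge0.
Qed.

End R_polynomial.

Definition coef_at (R : realType) (n : nat)
    (c : forall j : nat, mpoly.mpoly j.*2 R) (x : 'rV[R]_n) (j : nat) : R :=
  mpoly.meval (fun l : 'I_(j.*2) => entry x l) (c j).
Arguments coef_at {R n}.

Section divergence_of_F.
Context (R : realType) (m : nat) (lambda A1 : R) (P : {poly R}).
Context (a b : forall j : nat, mpoly.mpoly j.*2 R).
Hypothesis ab : forall j, (j < m)%N -> a j = b j \/ a j = - b j.

Local Notation n := m.*2.
Local Notation H := (H_map (n := n) (fun T => A1 * T) a b).
Local Notation F := (F_map (horner P) lambda H).
Implicit Types (x : 'rV[R]_n) (z : 'rV[R]_(n + 1)).

Local Notation av := (coef_at a).
Local Notation bv := (coef_at b).

Lemma coef_at_sqr x j : (j < m)%N -> bv x j ^+ 2 = av x j ^+ 2.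
Proof.
by move=> /ab; rewrite /coef_at => -[->|->] //; rewrite mpoly.mevalN sqrrN.
Qed.

Lemma F_map_lshift z (i : 'I_n) : F z 0 (lshift 1 i) =
  rotation (lsubmx z) 0 i
  + P.[z 0 (rshift n 0)] * (lambda * z 0 (lshift 1 i) + H (lsubmx z) 0 i).
Proof.
rewrite /F_map [X in X = _]mxE eq_row_mxl; congr (_ + _).
by rewrite mxE eq_row_mxl !mxE.
Qed.

Lemma F_map_rshift z : F z 0 (rshift n 0) =
  - z 0 (rshift n 0) * P.[z 0 (rshift n 0)].
Proof.
rewrite /F_map [X in X = _]mxE row_mxEr [X in _ + X]mxE row_mxEr.
by rewrite !mxE eqxx mulr0 addr0 mulr1n.
Qed.

Lemma dot_rotation x : \sum_i x 0 i * rotation x 0 i = 0.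
Proof.
pose G i := entry x i * (if odd i then entry x i.-1 else - entry x i.+1).
transitivity (\sum_(i < n) G i).
  by apply: eq_bigr => i _; rewrite /G mxE entry_ord.
rewrite (sum_ord_double _ _ G) big1// => j _.
by rewrite /G /= odd_double /=; ring.
Qed.

Lemma sum_sqr_pairs x : \sum_i x 0 i ^+ 2 =
  \sum_(j < m) (entry x j.*2 ^+ 2 + entry x j.*2.+1 ^+ 2).
Proof.
rewrite -(sum_ord_double _ _ (fun i => entry x i ^+ 2)).
by apply: eq_bigr => i _; rewrite entry_ord.
Qed.

(** In each pair, the cross term has the factor b_j^2 - a_j^2, which is 0. *)
Lemma dot_H x : \sum_i x 0 i * H x 0 i =
  \sum_(j < m) A1 * av x j * bv x j *
    (entry x j.*2 ^+ 2 - entry x j.*2.+1 ^+ 2).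
Proof.
pose G i := entry x i *
  (let j := i./2 in
   let t := A1 * (av x j * entry x j.*2 + bv x j * entry x j.*2.+1) in
   if odd i then - av x j * t else bv x j * t).
transitivity (\sum_(i < n) G i).
  by apply: eq_bigr => i _; rewrite /G mxE entry_ord.
rewrite (sum_ord_double _ _ G); apply: eq_bigr => j _.
rewrite /G /= odd_double /= doubleK uphalf_double.
have := coef_at_sqr x j (ltn_ord j); move: (av x j) (bv x j) => u v uv.
ring: uv.
Qed.

(** In each pair, a b is a^2 or - a^2, so that A1 a b (s^2 - t^2) is at most - A1 a^2 (s^2 + t^2),
    as A1 < 0. According to the sign, the slack is twice [e2] or twice [e3]. *)
Lemma dot_H_le x (K c : R) : 0 <= c -> A1 < 0 ->
  (forall j, (j < m)%N -> K <= c * (av x j ^+ 2 * A1 - lambda)) ->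
  K * (\sum_i x 0 i ^+ 2) <=
  - c * (lambda * (\sum_i x 0 i ^+ 2) + \sum_i x 0 i * H x 0 i).
Proof.
move=> c0 A10 hK; rewrite dot_H sum_sqr_pairs !mulr_sumr -big_split/= mulr_sumr.
apply: ler_sum => j _.
have {hK} := hK j (ltn_ord j).
have : av x j * bv x j = av x j ^+ 2 \/ av x j * bv x j = - av x j ^+ 2.
  have := ab j (ltn_ord j); rewrite /coef_at => -[->|->]; [left|right] => //.
  by rewrite mpoly.mevalN sqrrN mulNr.
move: (av x j) (bv x j) (entry x _) (entry x _) => u v s t uv hK.
have A1' : 0 <= - A1 by lra.
have e1 : 0 <= (c * (u ^+ 2 * A1 - lambda) - K) * (s ^+ 2 + t ^+ 2).
  by rewrite mulr_ge0 ?subr_ge0// addr_ge0 ?sqr_ge0.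
have e2 : 0 <= (- A1 * c * u ^+ 2) * s ^+ 2.
  exact: mulr_ge0 (mulr_ge0 (mulr_ge0 A1' c0) (sqr_ge0 u)) (sqr_ge0 s).
have e3 : 0 <= (- A1 * c * u ^+ 2) * t ^+ 2.
  exact: mulr_ge0 (mulr_ge0 (mulr_ge0 A1' c0) (sqr_ge0 u)) (sqr_ge0 t).
by rewrite -[A1 * u * v]mulrA; case: uv => ->; lra.
Qed.

(** Along the i-th axis the rotation component is constant, as it involves only the other entry of
    the pair, and so are the coefficients, as they involve only earlier pairs. The alternating sign
    makes the contributions of H cancel within each pair in the divergence. *)
Lemma partial_F_map_lshift z (i : 'I_n) :
  partial (fun w => F w 0 (lshift 1 i)) (lshift 1 i) z =
  P.[z 0 (rshift n 0)] *
  (lambda + (-1) ^+ odd i * (A1 * av (lsubmx z) i./2 * bv (lsubmx z) i./2)).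
Proof.
apply: derive_affine => h; rewrite !F_map_lshift.
set w := _ + z.
have wr : w 0 (rshift n 0) = z 0 (rshift n 0).
  by rewrite !mxE eq_rlshift andbF mulr0 add0r.
have wl : w 0 (lshift 1 i) = h + z 0 (lshift 1 i).
  by rewrite !mxE !eqxx mulr1.
have rw : rotation (lsubmx w) 0 i = rotation (lsubmx z) 0 i.
  rewrite !mxE !entry_lsubmx_shift; case: ifPn => i_odd.
    by rewrite (_ : _ == _ = false) ?mulr0 ?addr0//; lia.
  by rewrite (_ : _ == _ = false) ?mulr0 ?addr0//; lia.
have E (c : mpoly.mpoly i./2.*2 R) :
    mpoly.meval (fun l : 'I_(i./2.*2) => entry (lsubmx w) l) c =
    mpoly.meval (fun l : 'I_(i./2.*2) => entry (lsubmx z) l) c.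
  congr (mpoly.meval _ _); apply/funext => l; rewrite entry_lsubmx_shift.
  by rewrite (_ : _ == _ = false) ?mulr0 ?addr0//; have := ltn_ord l; lia.
rewrite wr wl rw !mxE; cbv zeta.
rewrite !E !entry_lsubmx_shift -/(coef_at _ _ _) -/(coef_at _ _ _).
case: ifPn => i_odd.
  have -> : (i./2.*2 == i :> nat) = false by lia.
  have -> : (i./2.*2.+1 == i :> nat) by lia.
  by rewrite /=; ring.
have -> : (i./2.*2 == i :> nat) by lia.
have -> : (i./2.*2.+1 == i :> nat) = false by lia.
by rewrite /=; ring.
Qed.

Lemma partial_F_map_rshift z :
  partial (fun w => F w 0 (rshift n 0)) (rshift n 0) z =
  - (P.[z 0 (rshift n 0)] + z 0 (rshift n 0) * P^`().[z 0 (rshift n 0)]).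
Proof.
rewrite /partial (_ : (fun w => _) =
  horner (- 'X * P) \o (fun z : 'rV[R]_(n + 1) => z 0 (rshift n 0)));
  last first.
  by apply/funext => x; rewrite F_map_rshift /= hornerM hornerN hornerX.
have h := is_derive_chain _ _ _ _ _ (delta_mx 0 (rshift n 0)) _ _
  (differentiable_coord z 0 (rshift n 0))
  (is_derive_poly (- 'X * P) (z 0 (rshift n 0))) (is_derive_entry _ _ _ _ _).
rewrite (@derive_val _ _ _ _ _ _ _ h) mxE !eqxx mulr1 derivM derivN derivX.
by rewrite hornerD !hornerM !hornerN hornerX hornerC; ring.
Qed.

Lemma divergence_F_map z :
  divergence F z = P.[z 0 (rshift n 0)] * (n%:R * lambda - 1)
    - z 0 (rshift n 0) * P^`().[z 0 (rshift n 0)].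
Proof.
rewrite /divergence big_split_ord/= big_ord1.
rewrite [X in _ + X]partial_F_map_rshift.
under eq_bigr do rewrite partial_F_map_lshift.
rewrite -mulr_sumr big_split/= sumr_const card_ord.
rewrite (sum_ord_double _ _ (fun i => (-1) ^+ odd i *
  (A1 * av (lsubmx z) i./2 * bv (lsubmx z) i./2))) big1 => [|j _].
  by rewrite mulr_natl; ring.
by rewrite /= odd_double /= doubleK uphalf_double; ring.
Qed.

Lemma dot_grad_F z :
  \sum_i sqr_add_poly_grad _ _ P z (delta_mx 0 i) * F z 0 i =
  2 * (P.[z 0 (rshift n 0)] *
        (lambda * (\sum_i (lsubmx z) 0 i ^+ 2)
         + \sum_i (lsubmx z) 0 i * H (lsubmx z) 0 i))
  - z 0 (rshift n 0) * P^`().[z 0 (rshift n 0)] * P.[z 0 (rshift n 0)].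
Proof.
rewrite big_split_ord/= big_ord1 F_map_rshift; congr (_ + _); last first.
  rewrite /sqr_add_poly_grad big1 ?add0r => [|i _].
    by rewrite mxE !eqxx mulr1; ring.
  by rewrite mxE eq_lrshift andbF mulr0.
transitivity (\sum_i (2 * (lsubmx z 0 i * rotation (lsubmx z) 0 i)
  + 2 * P.[z 0 (rshift n 0)] *
    (lambda * lsubmx z 0 i ^+ 2 + lsubmx z 0 i * H (lsubmx z) 0 i))).
  apply: eq_bigr => i _; rewrite F_map_lshift /sqr_add_poly_grad.
  rewrite (bigD1 i)//= big1 ?addr0 => [|j ji].
    move: (rotation _ 0 i) (H _ 0 i) => u v.
    by rewrite !mxE !eqxx eq_rlshift andbF mulr0 addr0/=; ring.
  by rewrite mxE eq_lshift (negbTE ji) andbF mulr0.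
rewrite big_split/= -!mulr_sumr dot_rotation mulr0 add0r big_split/= -mulr_sumr.
by rewrite mulrA.
Qed.

End divergence_of_F.

(** * Integrability *)

Lemma sqr_entry_le_sum (R : realType) (N : nat) (z : 'rV[R]_N) (i : 'I_N) :
  z 0 i ^+ 2 <= \sum_j z 0 j ^+ 2.
Proof.
by rewrite (bigD1 i)//= lerDl sumr_ge0// => j _; exact: sqr_ge0.
Qed.

Lemma sum_sqr_gt0 (R : realType) (N : nat) (z : 'rV[R]_N) :
  z != 0 -> 0 < \sum_j z 0 j ^+ 2.
Proof.
move=> z0; rewrite lt_neqAle sumr_ge0 ?andbT => [|j _]; last exact: sqr_ge0.
apply: contra_neq z0 => /esym z0; apply/rowP => i; rewrite mxE.
apply/eqP; rewrite -sqrf_eq0 eq_le sqr_ge0 andbT -z0.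
exact: sqr_entry_le_sum.
Qed.

Lemma measurable_euclid_norm_ge (R : realType) (N : nat) (r : R) :
  measurable [set x : 'rV[R]_N | r <= euclid_norm x].
Proof.
have mn : measurable_fun [set: 'rV[R]_N] (@euclid_norm R N).
  apply: (@measurableT_comp _ _ _ _ _ _ (@Num.sqrt R)).
    by apply: continuous_measurable_fun; exact: sqrt_continuous.
  apply: measurable_sum => i; apply: measurable_funX; exact: measurable_coord.
have := mn measurableT _ (measurable_itv `[r, +oo[).
rewrite setTI; congr measurable; apply/seteqP.
by split=> x /=; rewrite in_itv/= andbT.
Qed.

(** On the unit cube the squared norm is at most N, which is less than (N+1)^2. *)
Lemma euclid_norm_ge_notin_cube (R : realType) (N : nat) (x : 'rV[R]_N) :
  N.+1%:R <= euclid_norm x -> ~ cube 1 x.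
Proof.
move=> + x1; apply/negP; rewrite -ltNge -[ltRHS]ger0_norm// -sqrtr_sqr.
rewrite /euclid_norm ltr_sqrt ?exprn_gt0//.
apply: (@le_lt_trans _ _ (\sum_(i < N) (1 : R))).
  by apply: ler_sum => i _; rewrite -real_normK ?num_real// expr_le1.
rewrite sumr_const card_ord -natrX ltr_nat -[N in (N < _)%N]addn0.
by rewrite expnS expn1 mulnS addnC; lia.
Qed.

Section density.
Context (R : realType) (n : nat) (P : {poly R}) (c alpha : R).
Hypotheses (c_gt0 : 0 < c) (alpha_ge0 : 0 <= alpha).
Hypothesis P_ge : forall y, c * y ^+ 2 <= P.[y].

Local Notation Q := (sqr_add_poly _ _ P).

Lemma sqr_add_poly_ge (z : 'rV[R]_(n + 1)) :
  Num.min 1 c * (\sum_i z 0 i ^+ 2) <= Q z.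
Proof.
rewrite /sqr_add_poly big_split_ord/= big_ord1 mulrDr; apply: lerD.
  rewrite ler_piMl ?ge_min ?lexx// sumr_ge0// => i _; exact: sqr_ge0.
apply: le_trans (P_ge _).
by rewrite ler_wpM2r ?sqr_ge0// ge_min lexx orbT.
Qed.

Lemma sqr_add_poly_gt0 (z : 'rV[R]_(n + 1)) : z != 0 -> 0 < Q z.
Proof.
move=> /sum_sqr_gt0 z0; apply: lt_le_trans (sqr_add_poly_ge z).
by rewrite mulr_gt0// lt_min ltr01.
Qed.

Lemma rho_map_powR :
  rho_map (n := n) (horner P) alpha = fun z => Q z `^ (- alpha).
Proof.
apply/funext => z; rewrite /rho_map powRN div1r mxE; congr ((_ + _) `^ _)^-1.
by apply: eq_bigr => i _; rewrite mxE.
Qed.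

Lemma measurable_powR_sqr_add_poly :
  measurable_fun [set: 'rV[R]_(n + 1)] (fun z => Q z `^ (- alpha)).
Proof.
apply: (@measurableT_comp _ _ _ _ _ _ (fun x : R => x `^ (- alpha))) => //.
rewrite /sqr_add_poly; apply: measurable_funD.
  apply: measurable_sum => i; apply: measurable_funX.
  exact: measurable_coord.
apply: (@measurableT_comp _ _ _ _ _ _ (horner P)); last exact: measurable_coord.
by apply: continuous_measurable_fun; exact: continuous_horner.
Qed.

(** Outside the cube of half-side t = 2^m, Q is at least c' t^2. The integer [h] below alpha
    replaces the real power (t^2)^alpha by t^(2h), and 2h >= n + 2 is the decay exponent that
    [integrable_decay] asks for in dimension n + 1. *)
Lemma integrable_powR_sqr_add_poly (h : nat) :
  (n.+2 <= h.*2)%N -> h%:R <= alpha ->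
  (lebesgue_rV R (n + 1)).-integrable
    [set x | (n + 1).+1%:R <= euclid_norm x] (fun z => (Q z `^ (- alpha))%:E).
Proof.
move=> nh ha; pose c' := Num.min 1 c; have c'0 : 0 < c' by rewrite lt_min ltr01.
apply: (integrable_decay _ _ _ _ (c' `^ (- alpha))).
- exact: measurable_euclid_norm_ge.
- by apply: measurable_funTS; exact: measurable_powR_sqr_add_poly.
- by move=> *; exact: powR_ge0.
- by move=> x; exact: euclid_norm_ge_notin_cube.
move=> x m Dx /existsNP[i /negP]; rewrite -ltNge => xi.
set t : R := 2 ^+ m in xi *.
have t1 : 1 <= t by rewrite exprn_ege1// ler1n.
have t0 : 0 < t by exact: lt_le_trans t1.
have Qt : c' * t ^+ 2 <= Q x.
  apply: le_trans (sqr_add_poly_ge x); rewrite ler_wpM2l ?(ltW c'0)//.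
  apply: le_trans (sqr_entry_le_sum _ _ _ i).
  by rewrite -[leRHS]real_normK ?num_real// lerXn2r ?nnegrE// ltW.
have ct0 : 0 < c' * t ^+ 2 by rewrite mulr_gt0 ?exprn_gt0.
apply: (@le_trans _ _ ((c' * t ^+ 2) `^ (- alpha))).
  rewrite !powRN lef_pV2 ?posrE ?powR_gt0//; last exact: lt_le_trans Qt.
  by rewrite ge0_ler_powR ?nnegrE// (le_trans (ltW ct0)).
rewrite powRM ?(ltW c'0) ?sqr_ge0// ler_wpM2l ?powR_ge0// powRN.
rewrite lef_pV2 ?posrE ?powR_gt0 ?exprn_gt0//.
apply: (@le_trans _ _ ((t ^+ 2) `^ h%:R)).
  rewrite powR_mulrn ?sqr_ge0// -exprM mul2n ler_weXn2l//; lia.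
by rewrite ler_powR// exprn_ege1.
Qed.

End density.

(* For lambda <= -1 the lower bound (3 - n lambda)/2 suffices; for
   -1 < lambda < 0 the other one does, as s <= -lambda. *)
Lemma half_dim_lt_alpha (R : realFieldType) (n k lambda alpha s : R) :
  0 <= n -> 1 <= k -> lambda < 0 -> s <= - lambda -> 0 <= alpha ->
  (3 - n * lambda) / 2 < alpha ->
  2 * k + 1 - n * lambda < 2 * alpha * s ->
  (n + 3) / 2 < alpha.
Proof.
move=> n0 k1 l0 sl a0 h1 h2.
have [l1|l1] := lerP lambda (-1); first by nra.
rewrite ltNge; apply/negP => h; nra.
Qed.

(** * Positivity of the divergence off the hyperplane y = 0, and conclusion *)

Section density_of_F.
Context (R : realType) (m k : nat) (lambda A1 alpha : R) (d : nat -> R).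
Context (a b : forall j : nat, mpoly.mpoly j.*2 R).
Local Notation n := m.*2.
Local Notation P := (R_polynomial R k d).
Local Notation Q := (sqr_add_poly R n P).
Local Notation F :=
  (F_map (horner P) lambda (H_map (n := n) (fun T => A1 * T) a b)).
Hypotheses (k_ge1 : (1 <= k)%N) (A1_lt0 : A1 < 0).
Hypothesis d_gt0 : forall l : nat, (1 <= l <= k)%N -> 0 < d l.*2.
Hypothesis a_eq_b : forall j : nat, (j < m)%N -> a j = b j \/ a j = - b j.
Hypotheses (alpha_ge1 : 1 <= alpha)
  (alpha_gt : (3 - n%:R * lambda) / 2 < alpha).
Hypothesis alpha_bound : forall j : nat, (j < m)%N -> forall v : 'I_(j.*2) -> R,
  2 * k%:R + 1 - n%:R * lambda <=
  2 * alpha * (mpoly.meval v (a j) ^+ 2 * A1 - lambda).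

(** As grad rho = - alpha Q^(-alpha-1) grad Q, the factor Q^(-alpha-1) comes out of div(rho F) and
    leaves - alpha grad Q.F + Q div F, whose sign is given by [divergence_sign]. *)
Lemma divergence_scaled_gt0 (z : 'rV[R]_(n + 1)) : z 0 (rshift n 0) != 0 ->
  0 < divergence_scaled (fun w => Q w `^ (- alpha)) F z.
Proof.
move=> y0; set y : R := z 0 (rshift n 0) in y0.
have Py : 0 < P.[y].
  apply: lt_le_trans (R_polynomial_ge_sqr _ _ _ d_gt0 y k_ge1).
  by rewrite mulr_gt0 ?exprn_even_gt0// (d_gt0 1)// k_ge1.
have S0 : 0 <= \sum_i (lsubmx z) 0 i ^+ 2.
  by rewrite sumr_ge0// => i _; exact: sqr_ge0.
have QE : Q z = \sum_i (lsubmx z) 0 i ^+ 2 + P.[y].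
  by congr (_ + _); apply: eq_bigr => i _; rewrite mxE.
have Q0 : 0 < Q z by rewrite QE ltr_wpDl.
have gradE i : grad (fun w => Q w `^ (- alpha)) z 0 i =
    - alpha * Q z `^ (- alpha - 1) * sqr_add_poly_grad _ _ P z (delta_mx 0 i).
  rewrite mxE /partial.
  exact: (@derive_val _ _ _ _ _ _ _
    (is_derive_powR_sqr_add_poly _ _ P (- alpha) z (delta_mx 0 i) Q0)).
rewrite /divergence_scaled.
under eq_bigr do rewrite gradE -!mulrA.
rewrite -2!mulr_sumr dot_grad_F divergence_F_map.
have -> : Q z `^ (- alpha) = Q z `^ (- alpha - 1) * Q z.
  rewrite -[X in _ = _ * X]powRr1 ?(ltW Q0)// -powRD ?subrK//.
  by rewrite (gt_eqF Q0) implybT.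
rewrite -/y; have := divergence_sign R alpha (n%:R * lambda) (2 * k%:R)
  (\sum_i (lsubmx z) 0 i ^+ 2)
  (\sum_i (lsubmx z) 0 i * H_map (n := n) (fun T => A1 * T) a b (lsubmx z) 0 i)
  P.[y] (y * P^`().[y]) lambda Py.
move=> /(_ (mul_deriv_R_polynomial_ge _ _ _ d_gt0 y)).
move=> /(_ (mul_deriv_R_polynomial_le _ _ _ d_gt0 y) S0 alpha_ge1 alpha_gt).
have alpha0 : 0 <= 2 * alpha by rewrite mulr_ge0// (le_trans _ alpha_ge1).
have := dot_H_le _ _ lambda _ _ _ a_eq_b (lsubmx z) _ _ alpha0 A1_lt0
  (fun j jm => alpha_bound j jm _).
move=> dH /(_ dH).
rewrite -QE => E0.
have := mulr_gt0 (powR_gt0 (- alpha - 1) Q0) E0.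
by lra.
Qed.

End density_of_F.

Theorem theorem2 (R : realType) (n k : nat) (lambda A1 : R) (d : nat -> R)
    (a b : forall j : nat, mpoly.mpoly j.*2 R) (alpha : R)
    (n_ge2 : (2 <= n)%N) (n_even : ~~ odd n) (k_ge1 : (1 <= k)%N)
    (lambda_lt0 : lambda < 0) (A1_lt0 : A1 < 0)
    (d_gt0 : forall l : nat, (1 <= l <= k)%N -> 0 < d l.*2)
    (a_eq_b : forall j : nat, (j < n./2)%N -> a j = b j \/ a j = - b j)
    (a_bound : forall j : nat, (j < n./2)%N -> forall v : 'I_(j.*2) -> R,
       mpoly.meval v (a j) ^+ 2 < lambda / A1)
    (alpha_gt : forall j : nat, (j < n./2)%N -> forall v : 'I_(j.*2) -> R,
       alpha > Num.max 2 (Num.max ((3 - n%:R * lambda) / 2)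
         ((2 * k%:R + 1 - n%:R * lambda) /
            (2 * (mpoly.meval v (a j) ^+ 2 * A1 - lambda))))) :
  let f : R -> R := fun T => A1 * T in
  let Rf : R -> R := R_poly k d in
  is_density_function (F_map Rf lambda (H_map (n := n) f a b))
    (rho_map (n := n) Rf alpha).

Proof.
have [m nm] : exists m, n = m.*2 by exists n./2; rewrite even_halfK.
subst n; rewrite doubleK in a_eq_b a_bound alpha_gt.
move=> f Rf; rewrite {}/f {}/Rf R_polyE rho_map_powR.
have m_gt0 : (0 < m)%N by rewrite -double_gt0 ltnW.
(* Multiplying by A1 < 0 reverses the bound on a_j^2; the denominators in the condition on alpha are
   thus positive and can be cleared. *)
have s_gt0 j : (j < m)%N -> forall v : 'I_(j.*2) -> R,
    0 < mpoly.meval v (a j) ^+ 2 * A1 - lambda.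
  by move=> jm v; have := a_bound j jm v; rewrite ltr_ndivlMr// subr_gt0.
(* These bounds do not depend on j. They are read off at j = 0, where the polynomial has no
   variables and the valuation is a function on an empty type. *)
have [alpha_gt2 alpha_gt3] : 2 < alpha /\ (3 - m.*2%:R * lambda) / 2 < alpha.
  have := alpha_gt 0%N m_gt0 (fun=> 0).
  by rewrite !gt_max => /and3P[].
have alpha_bound j : (j < m)%N -> forall v : 'I_(j.*2) -> R,
    2 * k%:R + 1 - m.*2%:R * lambda <
    2 * alpha * (mpoly.meval v (a j) ^+ 2 * A1 - lambda).
  move=> jm v; have := alpha_gt j jm v; rewrite !gt_max => /and3P[_ _].
  by rewrite ltr_pdivrMr ?mulr_gt0 ?s_gt0// mulrCA mulrA.
have alpha_gt_half : (m.*2%:R + 3) / 2 < alpha.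
  apply: (half_dim_lt_alpha _ _ k%:R lambda _
    (mpoly.meval (fun=> 0) (a 0%N) ^+ 2 * A1 - lambda)) => //.
  - by rewrite ler1n.
  - by rewrite gerDr mulr_ge0_le0 ?sqr_ge0 ?ltW.
  - by lra.
  - exact: alpha_bound.
have d1 : 0 < d 2 by apply: (d_gt0 1%N); rewrite k_ge1.
have P_ge y : d 2 * y ^+ 2 <= (R_polynomial R k d).[y].
  exact: R_polynomial_ge_sqr.
split.
- by move=> x _; exact: powR_ge0.
- move=> x x0; have Q0 := sqr_add_poly_gt0 _ _ _ _ d1 P_ge x x0.
  split; first exact: differentiable_powR_sqr_add_poly.
  exact: continuous_grad_powR_sqr_add_poly.
(* The exponent is h = m + 1: then 2h = n + 2, and h < (n + 3)/2 < alpha. *)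
- exists (m.*2 + 1).+1%:R; first by rewrite ltr0n.
  apply: (integrable_powR_sqr_add_poly _ _ _ _ _ d1 _ P_ge m.+1) => //.
    by lra.
  have m2 : m.*2%:R = 2 * m%:R :> R by rewrite -mul2n natrM.
  by rewrite -natr1; lra.
(* The exceptional null set is the hyperplane y = 0, where R(y), and hence the whole of F but the
   rotation, vanishes. *)
- exists [set z : 'rV[R]_(m.*2 + 1) | z 0 (rshift m.*2 0) = 0]; split.
  + exact: (measurable_row_preimage _ _ _ _ (measurable_set1 0)).
  + exact: lebesgue_rV_coord0.
  + move=> z /= nz; apply: contrapT => /eqP y0; apply: nz.
    apply: divergence_scaled_gt0 => //; first by lra.
    by move=> j jm v; exact/ltW/alpha_bound.
Qed.
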